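(* Let $A$ be a locally compact abelian group and $M$ an LC $A$-module. Then $\{0\}\subseteq \mathrm{W}^\flat(M)\subseteq \Omega^\sharp(M)\subseteq M$. If moreover $A$ is compactly generated, then $\mathrm{W}^\flat(M)$ is a compact parafinite submodule, $\Omega^\sharp(M)$ is open and $M/\Omega^\sharp(M)$ is purely discrete, and the subquotient $\Omega^\sharp(M)/\mathrm{W}^\flat(M)$ is sheer.
   Context: All topological groups are Hausdorff. An LC $A$-module is an LCA group $M$ with a continuous action of the LCA group $A$ by topological automorphisms. An LC $A$-module is compact parafinite if it is compact and has no nonzero finite quotient module; it is purely discrete if it is discrete and has no nonzero finite submodule. $\mathrm{W}^\flat(M)$ (reduced polycompact radical) is the sum of all compact parafinite submodules of $M$. $\Omega^\sharp(M)$ (augmented codiscrete radical) is the intersection of all open submodules $U\subseteq M$ such that $M/U$ is purely discrete. $M$ is sheer if $\mathrm{W}^\flat(M)=\{0\}$ and $\Omega^\sharp(M)=M$. *)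

(* Defs.v *)
From HB Require Import structures.
From mathcomp Require Import all_boot all_order all_algebra.
From mathcomp Require Import all_classical all_reals all_analysis.
Set Implicit Arguments. Unset Strict Implicit. Unset Printing Implicit Defensive.
Import Order.TTheory GRing.Theory Num.Theory.
Local Open Scope classical_set_scope.
Local Open Scope ring_scope.

Definition LCA (A : topologicalZmodType) : Prop :=
  hausdorff_space A /\ locally_compact [set: A].

Definition is_subgroup (G : zmodType) (H : set G) : Prop :=
  H 0 /\ (forall x y, H x -> H y -> H (x - y)).

Definition gen_subgroup (G : zmodType) (S : set G) : set G :=
  [set x | forall H, is_subgroup H -> S `<=` H -> H x].

Definition compactly_generated (A : topologicalZmodType) : Prop :=
  exists K : set A, compact K /\ gen_subgroup K = [set: A].

Record lcmod (A : topologicalZmodType) := LCMod {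
  lc_car :> topologicalZmodType;
  act : A -> lc_car -> lc_car;
  lc_hausdorff : hausdorff_space lc_car;
  lc_locally_compact : locally_compact [set: lc_car];
  act_add : forall a (x y : lc_car), act a (x + y) = act a x + act a y;
  act_zero : forall x : lc_car, act 0 x = x;
  act_comp : forall a b (x : lc_car), act (a + b) x = act a (act b x);
  act_continuous : continuous (fun p : A * lc_car => act p.1 p.2)
}.
Arguments act {A} l _ _.

Section Defs.
Variables (A : topologicalZmodType) (M : lcmod A).

Definition submodule (S : set M) : Prop :=
  is_subgroup S /\ (forall a x, S x -> S (act M a x)).

Definition coset (K : set M) (x : M) : set M := [set y | K (y - x)].

Definition finite_index (H K : set M) : Prop :=
  exists s : seq M, H `<=` \bigcup_(x in [set` s]) coset K x.

(** Compact parafinite submodule: compact, and no nonzero finite quotient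
    module (quotient modules of N are N/K, K a closed submodule of N). *)
Definition compact_parafinite (N : set M) : Prop :=
  submodule N /\ compact N /\
  (forall K, submodule K -> closed K -> K `<=` N -> finite_index N K ->
     N `<=` K).

Definition purely_discrete : Prop :=
  (forall x : M, open [set x]) /\
  (forall S, submodule S -> finite_set S -> S `<=` [set 0]).

(** For a submodule U, the quotient M/U is purely discrete: every point of
    M/U is open in the quotient topology (i.e. every coset of U is open),
    and M/U has no nonzero finite submodule (submodules of M/U are V/U
    with V a submodule containing U). *)
Definition quotient_purely_discrete (U : set M) : Prop :=
  (forall x, open (coset U x)) /\
  (forall V, submodule V -> U `<=` V -> finite_index V U -> V `<=` U).

Definition Wflat : set M :=
  gen_subgroup (\bigcup_(N in [set N | compact_parafinite N]) N).

Definition Omegasharp : set M :=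
  [set x | forall U, submodule U -> open U -> quotient_purely_discrete U -> U x].

Definition sheer : Prop := Wflat = [set 0] /\ Omegasharp = [set: M].

End Defs.

(** [pi] realizes the subquotient H/L (L <= H submodules of M) as the
    LC A-module Q: on H, pi is an A-equivariant additive surjection onto Q
    with kernel L, continuous for the subspace topology of H and open
    (images of relatively open subsets of H are open). *)
Definition is_subquotient (A : topologicalZmodType) (M : lcmod A)
    (H L : set M) (Q : lcmod A) (pi : M -> Q) : Prop :=
  (forall x y, H x -> H y -> pi (x + y) = pi x + pi y) /\
  (forall a x, H x -> pi (act M a x) = act Q a (pi x)) /\
  pi @` H = [set: Q] /\
  (forall x, H x -> (pi x = 0 <-> L x)) /\
  {within H, continuous pi} /\
  (forall O : set M, open O -> open (pi @` (H `&` O))).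

Arguments Wflat {A} M.
Arguments Omegasharp {A} M.
Arguments purely_discrete {A} M.
Arguments sheer {A} M.

(* Main.v *)
Require Import Defs.
From HB Require Import structures.
From mathcomp Require Import all_boot all_order all_algebra.
From mathcomp Require Import all_classical all_reals all_analysis.
Set Implicit Arguments. Unset Strict Implicit. Unset Printing Implicit Defensive.
Import GRing.Theory.
Local Open Scope classical_set_scope.
Local Open Scope ring_scope.

(** Let K be a compact symmetric generating set of A.

    Openness of Omega#: there is an open subgroup C of M which is compact modulo
    the intersection of all open subgroups, so K C meets only finitely many
    cosets of C.  Among the open submodules U with M/U purely discrete pick one,
    U0, for which K C /\ U0 meets as few of these cosets as possible.  If U2 <= U0
    is another such submodule, minimality gives K C /\ U0 <= (C /\ U0) + U2, hence
    (C /\ U0) + U2 is a submodule in which U2 has finite index, and so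
    C /\ U0 <= U2.  Thus Omega# contains the open set C /\ U0.

    Compactness of W_flat is the dual argument: some compact subgroup C is open
    in the closure of the union of all compact subgroups.  With C' the set of
    x in C such that K x <= C, pick a compact parafinite N0 for which C' + N0
    contains as many of the finitely many cosets of C' in C as possible.  For
    every compact parafinite N >= N0, the set N /\ (C + N0) is then K-stable, so
    it is a submodule of finite index in N, and N <= C + N0. *)

(** * Finite subcovers and finite intersections of neighbourhoods *)

(** Otherwise the complements in [K] of the finite unions generate a proper filter. At a cluster
    point [x] in [K] it must meet [f x], although [B [:: x]] avoids [f x]. *)
Lemma compact_finite_cover (T : topologicalType) (K : set T) (f : T -> set T) :
  compact K -> (forall x, K x -> nbhs x (f x)) ->
  exists2 s : seq T, [set` s] `<=` K & K `<=` \bigcup_(x in [set` s]) f x.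
Proof.
move=> cK Kf; apply: contrapT => nocover.
pose D := [set s : seq T | [set` s] `<=` K].
pose B (s : seq T) := K `\` \bigcup_(x in [set` s]) f x.
have Bf : Filter (filter_from D B).
  apply: filter_from_filter; first by exists [::].
  move=> s t Ds Dt; exists (s ++ t).
    by move=> x; rewrite /= mem_cat => /orP[/Ds|/Dt].
  move=> x [Kx nx]; split; split=> // -[y ys fy]; apply: nx; exists y => //=;
    by rewrite mem_cat ys ?orbT.
have Bp : ProperFilter (filter_from D B).
  apply: filter_from_proper => s Ds; apply: contrapT => B0; apply: nocover.
  exists s => // x Kx; apply: contrapT => nx; apply: B0; by exists x.
have [] := cK _ Bp; first by exists [::] => // x [].
move=> x [Kx]; move=> /(_ (B [:: x]) (f x)) [].
- by exists [:: x] => // y /=; rewrite inE => /eqP ->.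
- exact: Kf.
- by move=> y [[_ ny] fy]; apply: ny; exists x => //=; rewrite inE.
Qed.

Lemma nbhs_seq (T : topologicalType) (I : eqType) (p : T) (s : seq I) (P : I -> set T) :
  (forall i, i \in s -> nbhs p (P i)) -> nbhs p [set x | forall i, i \in s -> P i x].
Proof.
elim: s => [|i s IH] sP; first exact: nearW.
have Pi := sP i (mem_head _ _).
have Ps : nbhs p [set x | forall i, i \in s -> P i x].
  by apply: IH => j js; apply: sP; rewrite inE js orbT.
apply: filterS (filterI Pi Ps) => x [Pix Psx] j.
by rewrite inE => /orP[/eqP ->|/Psx].
Qed.

(** * Subgroups of an abelian group and sums of subsets *)

Section Subgroups.
Context (G : zmodType).
Implicit Types H : set G.

Lemma subgroup0 H : is_subgroup H -> H 0. Proof. by case. Qed.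

Lemma subgroupB H x y : is_subgroup H -> H x -> H y -> H (x - y).
Proof. by case=> _; apply. Qed.

Lemma subgroupN H x : is_subgroup H -> H x -> H (- x).
Proof. by move=> sH Hx; rewrite -sub0r; apply: subgroupB => //; apply: subgroup0. Qed.

Lemma subgroupD H x y : is_subgroup H -> H x -> H y -> H (x + y).
Proof.
by move=> sH Hx Hy; rewrite -(opprK y); apply: subgroupB => //; apply: subgroupN.
Qed.

Lemma subgroup_same_coset H x y z :
  is_subgroup H -> H (x - z) -> H (y - z) -> H (x - y).
Proof.
move=> sH Hx Hy; have -> : x - y = x - z - (y - z) by rewrite opprB addrA subrK.
exact: subgroupB.
Qed.

Lemma gen_subgroupP (S : set G) : is_subgroup (gen_subgroup S).
Proof.
split=> [H [] //|x y Sx Sy H sH SH].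
by apply: subgroupB => //; [apply: Sx|apply: Sy].
Qed.

Lemma sub_gen_subgroup (S : set G) : S `<=` gen_subgroup S.
Proof. by move=> x Sx H _; apply. Qed.

Lemma subgroup_set0 : is_subgroup [set 0 : G].
Proof. by split=> // x y -> ->; rewrite subr0. Qed.

Lemma subgroupI H K : is_subgroup H -> is_subgroup K -> is_subgroup (H `&` K).
Proof.
move=> sH sK; split; first by split; apply: subgroup0.
by move=> x y [? ?] [? ?]; split; apply: subgroupB.
Qed.

Definition sumset (S T : set G) : set G := [set x + y | x in S & y in T].

Lemma sumsetP (S T : set G) x y : S x -> T y -> sumset S T (x + y).
Proof. by move=> Sx Ty; exists x => //; exists y. Qed.

Lemma sumset_subl (S T : set G) : T 0 -> S `<=` sumset S T.
Proof. by move=> T0 x Sx; rewrite -(addr0 x); apply: sumsetP. Qed.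

Lemma sumset_subr (S T : set G) : S 0 -> T `<=` sumset S T.
Proof. by move=> S0 x Tx; rewrite -(add0r x); apply: sumsetP. Qed.

Lemma subgroup_sumset H K :
  is_subgroup H -> is_subgroup K -> is_subgroup (sumset H K).
Proof.
move=> sH sK; split; first by rewrite -(addr0 0); apply: sumsetP; apply: subgroup0.
move=> _ _ [x Hx [y Ky <-]] [x' Hx' [y' Ky' <-]].
by rewrite opprD addrACA; apply: sumsetP; apply: subgroupB.
Qed.

Lemma sumset_sub H (S T : set G) :
  is_subgroup H -> S `<=` H -> T `<=` H -> sumset S T `<=` H.
Proof. by move=> sH SH TH _ [x /SH Hx [y /TH Hy <-]]; apply: subgroupD. Qed.

End Subgroups.

(** * Translations, closed subgroups and compact sets in topological groups *)

Section TopologicalGroups.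
Context (G : topologicalZmodType).
Implicit Types H U : set G.

Lemma addl_continuous (a : G) : continuous (fun x : G => a + x).
Proof.
move=> x; apply: (@continuous_comp _ _ _ (fun x => (a, x)) (fun x : G * G => x.1 + x.2)).
  by apply: cvg_pair => /=; [exact: cvg_cst|exact: cvg_id].
exact: add_continuous.
Qed.

Lemma subl_continuous (a : G) : continuous (fun x : G => x - a).
Proof.
rewrite (_ : (fun x => x - a) = +%R (- a)); first exact: addl_continuous.
by apply/funext => x; exact: addrC.
Qed.

Lemma nbhs_translate (a x : G) U : nbhs (a + x) U -> nbhs x [set y | U (a + y)].
Proof. exact: addl_continuous. Qed.

Lemma nbhs_translate0 (x : G) U : nbhs 0 U -> nbhs x [set y | U (y - x)].
Proof.
rewrite -(addNr x) => /nbhs_translate; congr nbhs.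
by apply/seteqP; split=> y /=; rewrite addrC.
Qed.

Lemma nbhs_opp0 U : nbhs 0 U -> nbhs 0 [set x : G | U (- x)].
Proof. by move=> U0; apply: (@opp_continuous G 0); rewrite oppr0. Qed.

Lemma nbhs_subgroup_open H : is_subgroup H -> nbhs 0 H -> open H.
Proof.
move=> sH H0; rewrite openE => x Hx; apply: filterS (nbhs_translate0 x H0).
by move=> y /= Hyx; rewrite -(subrK x y); apply: subgroupD.
Qed.

Lemma closure_subgroup H : is_subgroup H -> is_subgroup (closure H).
Proof.
move=> sH; split; first by apply: subset_closure; apply: subgroup0.
move=> x y cx cy B nB.
have := @sub_continuous G (x, y) B nB; case=> -[V W] [/= Vx Wy] VW.
have [x' [Hx' Vx']] := cx _ Vx; have [y' [Hy' Wy']] := cy _ Wy.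
by exists (x' - y'); split; [apply: subgroupB|apply: (VW (x', y'))].
Qed.

(** A point [x] of the closure lies in [L], and some [y] in [H] has [y - x] in [U]. This difference
    lies in [L], hence in [H]. *)
Lemma relatively_open_subgroup_closed H L U :
  is_subgroup H -> is_subgroup L -> closed L -> H `<=` L ->
  nbhs 0 U -> L `&` U `<=` H -> closed H.
Proof.
move=> sH sL cL HL U0 LU x cx.
have Lx : L x by apply: cL; apply: closureS cx.
have [y [Hy Uyx]] := cx _ (nbhs_translate0 x U0).
rewrite -(subrK y x); apply: subgroupD => //; rewrite -opprB.
apply: subgroupN => //; apply: LU; split => //; apply: subgroupB => //; exact: HL.
Qed.

Lemma open_subgroup_closed H : is_subgroup H -> open H -> closed H.
Proof.
move=> sH oH; apply: (@relatively_open_subgroup_closed H setT H) => //.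
by apply: open_nbhs_nbhs; split=> //; apply: subgroup0.
Qed.

Lemma compact_sumset (S T : set G) : compact S -> compact T -> compact (sumset S T).
Proof.
move=> cS cT; rewrite (_ : sumset S T = (fun p : G * G => p.1 + p.2) @` (S `*` T)).
  apply: continuous_compact; last exact: compact_setX.
  by apply: continuous_subspaceT; exact: add_continuous.
apply/seteqP; split=> z; first by move=> [x Sx [y Ty <-]]; exists (x, y).
by move=> [[x y] [/= Sx Ty] <-]; apply: sumsetP.
Qed.

Lemma compact_opp (S : set G) : compact S -> compact (-%R @` S).
Proof.
move=> cS; apply: continuous_compact cS; apply: continuous_subspaceT.
exact: opp_continuous.
Qed.

Lemma symmetric_compact_nbhs0 : locally_compact [set: G] ->
  exists V : set G, [/\ nbhs 0 V, compact V & forall x, V x -> V (- x)].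
Proof.
move=> /(_ 0 I) [V]; rewrite withinET => nV [cV _]; exists (V `|` -%R @` V); split.
- by apply: filterS nV => x; left.
- by apply: compactU => //; apply: compact_opp.
- by move=> x [Vx|[y Vy <-]]; [right; exists x|left; rewrite opprK].
Qed.

(** * Open subgroups and their intersection *)

(** For locally compact Hausdorff [G] this is the identity component. *)
Definition open_core : set G := [set x | forall H, is_subgroup H -> open H -> H x].

Lemma open_core_subgroup : is_subgroup open_core.
Proof.
split=> [H sH _|x y Dx Dy H sH oH]; first exact: subgroup0.
by apply: subgroupB => //; [apply: Dx|apply: Dy].
Qed.

(* Van Dantzig's theorem for the quotient by [open_core], without forming the quotient. *)
Lemma open_subgroup_compact_mod_core : locally_compact [set: G] ->
  exists C V : set G,
    [/\ is_subgroup C, open C, compact V & C `<=` sumset V open_core].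
Proof.
move=> lcG; have [V [V0 cV _]] := symmetric_compact_nbhs0 lcG.
pose D := open_core; pose DV := sumset D V°.
have sD : is_subgroup D := open_core_subgroup.
have oDV : open DV.
  rewrite openE => _ [d Dd [v Vv <-]].
  have : nbhs (- d + (d + v)) V° by rewrite addKr; apply: nbhs_interior.
  move/nbhs_translate; apply: filterS => y /= Vy.
  by rewrite -(addNKr d y); apply: sumsetP.
(* [B] is the part of [V] not reached by [D + V°]. Since [D] lies in [DV], every point of [B] is
   outside some open subgroup; by compactness finitely many of these suffice, and their intersection
   [O] avoids [B]. *)
pose B := V `&` ~` DV.
have cB : compact B by apply: compact_closedI => //; apply: open_closedC.
have /choice[h hP] x : exists H, B x -> [/\ is_subgroup H, open H & ~ H x].
  have [[_ nDV]|] := pselect (B x); last by exists setT.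
  apply: contrapT => nH; apply: nDV; apply: sumset_subl; first exact: V0.
  move=> H sH oH; apply: contrapT => nHx; apply: nH; by exists H.
have Bh x : B x -> nbhs x (~` h x).
  move=> /hP[sH oH nH]; apply: open_nbhs_nbhs; split=> //.
  by apply: closed_openC; apply: open_subgroup_closed.
have [s sB Bs] := compact_finite_cover cB Bh.
pose O := [set y | forall x, x \in s -> h x y].
have sO : is_subgroup O.
  split=> [x /sB /hP[sH _ _]|x y Ox Oy z zs]; first exact: subgroup0.
  by have [sH _ _] := hP _ (sB _ zs); apply: subgroupB => //; [apply: Ox|apply: Oy].
have oO : open O.
  apply: nbhs_subgroup_open => //; apply: nbhs_seq => x /sB /hP[sH oH _].
  by apply: open_nbhs_nbhs; split=> //; apply: subgroup0.
have OB x : O x -> ~ B x by move=> Ox /Bs[y ys]; apply; apply: Ox.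
have DO : D `<=` O by move=> x; apply.
(* As [O] avoids [B], the compact set [X] lies in [W]. Thus [W] is open, stable under [D], and equal
   to [D + X]. *)
pose W := O `&` DV; pose X := V `&` O.
have cX : compact X by apply: compact_closedI => //; apply: open_subgroup_closed.
have XW : X `<=` W.
  by move=> x [Vx Ox]; split=> //; apply: contrapT => nx; apply: (OB x Ox).
have DW d w : D d -> W w -> W (d + w).
  move=> Dd [Ow [d' Dd' [v Vv dv]]]; split; first exact: (subgroupD sO (DO _ Dd) Ow).
  by rewrite -dv addrA; apply: sumsetP => //; exact: (subgroupD sD).
have WDX w : W w -> sumset D X w.
  move=> [Ow [d Dd [v Vv dv]]]; rewrite -dv; apply: sumsetP => //.
  split; first exact: interior_subset.
  by rewrite -(addKr d v) dv; exact: (subgroupD sO (subgroupN sO (DO _ Dd)) Ow).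
have oW : open W by apply: openI.
have N0 : nbhs 0 [set n | X `<=` [set x | W (x + n)]].
  move/compact_near_coveringP: cX; apply => x Xx.
  have := @add_continuous G (x, 0) W; rewrite /= addr0; apply.
  by apply: open_nbhs_nbhs; split=> //; apply: XW.
have WN n w : X `<=` [set x | W (x + n)] -> W w -> W (w + n).
  by move=> Xn /WDX[d Dd [x Xx <-]]; rewrite -addrA; apply: DW => //; apply: Xn.
have W0 : W 0.
  split; first exact: (subgroup0 sO).
  by rewrite -(addr0 0); apply: sumsetP; [exact: (subgroup0 sD)|exact: V0].
(* [C] is the stabiliser of [W] under translation. It is open because a small translation keeps [X],
   hence [W = D + X], inside [W]; it lies in [W] because [W] contains 0. *)
pose C := [set x | forall w, W w -> W (w + x) /\ W (w - x)].
exists C, V; have sC : is_subgroup C.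
  split=> [w Ww|x y Cx Cy w Ww]; first by rewrite addr0 subr0.
  have [Wx Wx'] := Cx _ Ww; split.
    by rewrite addrA; apply: (Cy _ Wx).2.
  by rewrite opprB addrCA addrC; apply: (Cy _ Wx').1.
split=> //.
  apply: nbhs_subgroup_open => //; apply: filterS (filterI N0 (nbhs_opp0 N0)).
  by move=> n [Xn Xn'] w Ww; split; apply: WN.
move=> x /(_ 0 W0)[]; rewrite add0r => /WDX[d Dd [v [Vv _] <-]] _.
by rewrite addrC; apply: sumsetP.
Qed.

(** * The union of the compact subgroups *)

(** The dual counterpart of [open_core]: in an LCA group its closure is the annihilator of the
    identity component of the Pontryagin dual. *)
Definition compact_elements : set G :=
  [set x | exists N, [/\ is_subgroup N, compact N & N x]].

Lemma compact_elements_subgroup : is_subgroup compact_elements.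
Proof.
split; first by exists [set 0]; split=> //; [exact: subgroup_set0|exact: compact_set1].
move=> x y [N [sN cN Nx]] [N' [sN' cN' Ny]]; exists (sumset N N').
split; [exact: subgroup_sumset|exact: compact_sumset|].
by apply: sumsetP => //; apply: subgroupN.
Qed.

Lemma compact_subgroup_seq (s : seq G) : [set` s] `<=` compact_elements ->
  exists N, [/\ is_subgroup N, compact N & [set` s] `<=` N].
Proof.
elim: s => [|x s IH] sB.
  by exists [set 0]; split=> //; [exact: subgroup_set0|exact: compact_set1].
have [N [sN cN Nx]] : compact_elements x by apply: sB; rewrite /= inE eqxx.
have [|N' [sN' cN' sN'']] := IH.
  by move=> y ys; apply: sB; rewrite /= inE ys orbT.
exists (sumset N N'); split; [exact: subgroup_sumset|exact: compact_sumset|].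
move=> y /=; rewrite inE => /orP[/eqP ->|ys].
  by apply: sumset_subl => //; apply: subgroup0.
by apply: sumset_subr; [apply: subgroup0|apply: sN''].
Qed.

(* H is the closure of the union of the compact subgroups and V a compact
   neighbourhood of 0.  By density, the finitely many translates of V needed to
   cover (V `&` H) + (V `&` H) can be centred at compact elements; the centres lie
   in one compact subgroup N, and (V `&` H) + N is a subgroup. *)
Lemma compact_subgroup_open_in_compact_elements : locally_compact [set: G] ->
  exists C U : set G, [/\ is_subgroup C, compact C, C `<=` closure compact_elements,
    nbhs 0 U & closure compact_elements `&` U `<=` C].
Proof.
move=> lcG; have [V [V0 cV Vopp]] := symmetric_compact_nbhs0 lcG.
pose H := closure compact_elements; pose VH := V `&` H.
have sH : is_subgroup H by apply: closure_subgroup; exact: compact_elements_subgroup.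
have cVH : compact VH by apply: compact_closedI => //; exact: closed_closure.
have cVH2 : compact (sumset VH VH) by apply: compact_sumset.
have VH2H : sumset VH VH `<=` H by apply: sumset_sub => // x [].
have /choice[b bP] x : exists b, sumset VH VH x -> compact_elements b /\ V° (x - b).
  have [/VH2H Hx|] := pselect (sumset VH VH x); last by exists 0.
  have := nbhs_opp0 (nbhs_interior V0) => /(nbhs_translate0 x) /Hx[b [Bb Vb]].
  by exists b; split=> //; move: Vb; rewrite /= opprB.
have bV x : sumset VH VH x -> nbhs x [set y | V (y - b x)].
  by move=> /bP[_ Vx]; apply: (subl_continuous Vx).
have [s sVH VHs] := compact_finite_cover cVH2 bV.
have [|N [sN cN bN]] := @compact_subgroup_seq [seq b x | x <- s].
  by move=> y /= /mapP[x /sVH /bP[Bb _] ->].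
have NB : N `<=` H by move=> x Nx; apply: subset_closure; exists N.
have VHN x : sumset VH VH x -> sumset VH N x.
  move=> VHx; have [y ys Vxy] := VHs _ VHx.
  have Nb : N (b y) by apply: bN; apply: map_f.
  rewrite -(subrK (b y) x); apply: sumsetP => //; split=> //.
  exact: (subgroupB sH (VH2H _ VHx) (NB _ Nb)).
exists (sumset VH N), V; split=> //.
- split.
    apply: sumset_subl; first exact: subgroup0.
    by split; [exact: nbhs_singleton|exact: (subgroup0 sH)].
  move=> _ _ [v Vv [n Nn <-]] [v' [Vv' Hv'] [n' Nn' <-]].
  rewrite opprD addrACA.
  have /VHN[w Vw [m Nm <-]] : sumset VH VH (v - v').
    by apply: sumsetP => //; split; [exact: Vopp|exact: (subgroupN sH)].
  by rewrite -addrA; apply: sumsetP => //; apply: subgroupD => //; apply: subgroupB.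
- exact: compact_sumset.
- by apply: sumset_sub => // x [].
- by move=> x [Hx Vx]; apply: sumset_subl => //; apply: subgroup0.
Qed.

End TopologicalGroups.

Arguments open_core {G}.
Arguments compact_elements {G}.

(** * Extremal choice by counting a finite trace *)

Lemma ltn_count_in (I : eqType) (s : seq I) (p q : pred I) (i : I) :
  {in s, forall j, p j -> q j} -> i \in s -> q i -> ~~ p i ->
  (count p s < count q s)%N.
Proof.
move=> pq si qi npi; rewrite -[count q s]size_filter -(count_predC p).
have -> : count p [seq x <- s | q x] = count p s.
  rewrite count_filter; apply: eq_in_count => j js /=.
  by case: (boolP (p j)) => // /(pq j js) ->.
rewrite -addn1 leq_add2l -has_count; apply/hasP.
by exists i; rewrite ?mem_filter ?qi.
Qed.

(** Take [x] whose trace on [s] has the fewest elements; a proper subset would have a smaller count.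
    It replaces a chain condition on the family [P], which may be infinite. *)
Lemma minimal_finite_trace (T : Type) (I : eqType) (P : set T) (s : seq I)
    (h : T -> set I) : P !=set0 ->
  exists2 x, P x & forall y, P y ->
    (forall i, i \in s -> h y i -> h x i) -> forall i, i \in s -> h x i -> h y i.
Proof.
move=> [x0 Px0]; pose c x := count (fun i => `[< h x i >]) s.
have exn : exists n, `[< exists2 x, P x & c x = n >].
  by exists (c x0); apply/asboolP; exists x0.
case: (ex_minnP exn) => n /asboolP[x Px cx] nmin; exists x => // y Py yx i si hxi.
apply: contrapT => nhyi.
have := nmin (c y); rewrite -cx leqNgt => /(_ _)/negP; apply.
  by apply/asboolP; exists y.
apply: (@ltn_count_in _ s _ _ i) => //; last 2 first.
- exact/asboolP.
- exact/asboolPn.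
by move=> j js /asboolP hj; apply/asboolP; apply: yx.
Qed.

(** * Submodules of LC modules and finite index *)

Section Modules.
Context (A : topologicalZmodType) (M : lcmod A).
Implicit Types (S N U K : set M) (a : A) (x y : M).

Lemma act0 a : act M a 0 = 0.
Proof. by apply: (addrI (act M a 0)); rewrite -act_add !addr0. Qed.

Lemma actN a x : act M a (- x) = - act M a x.
Proof. by apply: (addrI (act M a x)); rewrite -act_add !subrr act0. Qed.

Lemma actB a x y : act M a (x - y) = act M a x - act M a y.
Proof. by rewrite act_add actN. Qed.

Lemma act_continuousr a : continuous (act M a).
Proof.
move=> x; apply: (@continuous_comp _ _ _ (fun x => (a, x)) (fun p => act M p.1 p.2)).
  by apply: cvg_pair => /=; [exact: cvg_cst|exact: cvg_id].
exact: act_continuous.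
Qed.

Lemma compact_act (K : set A) (V : set M) : compact K -> compact V ->
  compact [set act M a x | a in K & x in V].
Proof.
move=> cK cV.
rewrite (_ : [set _ | _ in _ & _ in _] = (fun p => act M p.1 p.2) @` (K `*` V)).
  apply: continuous_compact; last exact: compact_setX.
  by apply: continuous_subspaceT; exact: act_continuous.
apply/seteqP; split=> z; first by move=> [x Sx [y Ty <-]]; exists (x, y).
by move=> [[x y] [/= Sx Ty] <-]; exists x => //; exists y.
Qed.

Lemma act_preimage_subgroup a S : is_subgroup S -> is_subgroup (act M a @^-1` S).
Proof.
move=> sS; split=> /= [|x y Sx Sy]; first by rewrite act0; apply: subgroup0.
by rewrite actB; apply: subgroupB.
Qed.

Lemma act_open_core a x : open_core x -> open_core (act M a x).
Proof.
move=> Dx H sH oH; apply: (Dx (act M a @^-1` H)).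
  exact: act_preimage_subgroup.
by apply: open_comp => // y _; apply: act_continuousr.
Qed.

Lemma act_image_subgroup a S : is_subgroup S -> is_subgroup (act M a @` S).
Proof.
move=> sS; split; first by exists 0; [exact: subgroup0|rewrite act0].
move=> _ _ [x Sx <-] [y Sy <-]; exists (x - y); last exact: actB.
exact: subgroupB.
Qed.

Lemma act_compact_elements a x :
  compact_elements x -> compact_elements (act M a x).
Proof.
move=> [N [sN cN Nx]]; exists (act M a @` N); split; last by exists x.
  exact: act_image_subgroup.
apply: continuous_compact => //; apply: continuous_subspaceT.
exact: act_continuousr.
Qed.

Lemma act_closure S a : (forall x, S x -> S (act M a x)) ->
  forall x, closure S x -> closure S (act M a x).
Proof.
move=> aS x cx B /act_continuousr /cx[y [Sy By]].
by exists (act M a y); split=> //; apply: aS.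
Qed.

Lemma submoduleI S U : submodule S -> submodule U -> submodule (S `&` U).
Proof.
move=> [sS aS] [sU aU]; split; first exact: subgroupI.
by move=> a x [Sx Ux]; split; [apply: aS|apply: aU].
Qed.

Lemma submodule_sumset S U : submodule S -> submodule U -> submodule (sumset S U).
Proof.
move=> [sS aS] [sU aU]; split; first exact: subgroup_sumset.
by move=> a _ [x Sx [y Uy <-]]; rewrite act_add; apply: sumsetP; [apply: aS|apply: aU].
Qed.

Lemma submodule_closure S : submodule S -> submodule (closure S).
Proof.
move=> [sS aS]; split; first exact: closure_subgroup.
by move=> a; apply: act_closure; apply: aS.
Qed.

Lemma submodule_set0 : submodule ([set 0] : set M).
Proof. by split=> [|a x ->]; [exact: subgroup_set0|exact: act0]. Qed.

Lemma coset_open U x : is_subgroup U -> open U -> open (coset U x).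
Proof.
move=> sU oU; apply: (@open_comp M M (fun y => y - x)) => // y _.
exact: subl_continuous.
Qed.

Lemma finite_indexS N N' K K' : N' `<=` N -> K `<=` K' ->
  finite_index N K -> finite_index N' K'.
Proof.
by move=> NN KK [s Ns]; exists s => x /NN /Ns[y ys Ky]; exists y => //; apply: KK.
Qed.

Lemma finite_index_sumset N K : is_subgroup K ->
  finite_index N K -> finite_index (sumset N K) K.
Proof.
move=> sK [s Ns]; exists s => _ [n /Ns[y ys Kny] [k Kk <-]]; exists y => //.
by rewrite /coset /= addrAC; apply: subgroupD.
Qed.

(** The centres in [finite_index] may lie outside [N]. Each one whose coset of [K] meets [N] is
    moved to a point of [N] in that coset; the others get the junk value 0. *)
Lemma finite_index_setI N K : is_subgroup N -> is_subgroup K ->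
  finite_index N K -> finite_index N (N `&` K).
Proof.
move=> sN sK [s Ns].
have /choice[g gP] x : exists y, (exists z, N z /\ K (z - x)) -> N y /\ K (y - x).
  by have [[y yP]|] := pselect (exists z, N z /\ K (z - x)); [exists y|exists 0].
exists [seq g x | x <- s] => y Ny; have [x xs Kyx] := Ns _ Ny.
have [|Ng Kg] := gP x; first by exists y.
exists (g x); first exact: map_f.
split; first exact: (subgroupB sN).
exact: (subgroup_same_coset sK Kyx Kg).
Qed.

Lemma compact_finite_index (X : set M) U K : compact X -> is_subgroup X ->
  nbhs 0 U -> X `&` U `<=` K -> finite_index X K.
Proof.
move=> cX sX U0 XU.
have [s sX' Xs] := compact_finite_cover cX (fun x _ => nbhs_translate0 x U0).
exists s => y Xy; have [x xs Uyx] := Xs _ Xy; exists x => //; apply: XU.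
by split=> //; apply: subgroupB => //; apply: sX'.
Qed.

Lemma compact_cosets (X : set M) U : compact X -> is_subgroup U -> open U ->
  finite_index X U.
Proof.
move=> cX sU oU.
have U0 : nbhs 0 U by apply: open_nbhs_nbhs; split=> //; apply: subgroup0.
have [s _ Xs] := compact_finite_cover cX (fun x _ => nbhs_translate0 x U0).
by exists s.
Qed.

(** * Compact parafinite submodules and purely discrete quotients *)

(** [sumset S U] modulo [U] is the image of [S] in M/U, a finite submodule, hence zero. This form
    frees [S] from having to contain [U]. *)
Lemma quotient_purely_discrete_sub U S : submodule U ->
  quotient_purely_discrete U -> submodule S -> finite_index S U -> S `<=` U.
Proof.
move=> mU [_ qU] mS fS; apply: (@subset_trans _ (sumset S U)).
  by apply: sumset_subl; apply: subgroup0; case: mU.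
apply: qU; first exact: submodule_sumset.
  by apply: sumset_subr; apply: subgroup0; case: mS.
by apply: finite_index_sumset => //; case: mU.
Qed.

(** The intersection of [N] and [K] is a closed submodule of finite index in [N], so it is all of
    [N]. This form frees [K] from having to lie in [N]. *)
Lemma compact_parafinite_sub N K : compact_parafinite N ->
  submodule K -> closed K -> finite_index N K -> N `<=` K.
Proof.
move=> [mN [cN pN]] mK cK fK; apply: (@subset_trans _ (N `&` K)); last by move=> ? [].
apply: pN.
- exact: submoduleI.
- by apply: closedI => //; apply: compact_closed => //; exact: lc_hausdorff.
- by move=> ? [].
- by apply: finite_index_setI => //; [case: mN|case: mK].
Qed.

(** A closed submodule of finite index in the sum has finite index in each summand, so it contains
    both. *)
Lemma compact_parafinite_sumset N N' : compact_parafinite N ->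
  compact_parafinite N' -> compact_parafinite (sumset N N').
Proof.
move=> pN pN'; have [mN [cN _]] := pN; have [mN' [cN' _]] := pN'.
have [sN _] := mN; have [sN' _] := mN'.
split; first exact: submodule_sumset; split; first exact: compact_sumset.
move=> K mK cK _ fK; apply: sumset_sub; first by case: mK.
  apply: compact_parafinite_sub => //; apply: finite_indexS fK => //.
  by apply: sumset_subl; apply: subgroup0.
apply: compact_parafinite_sub => //; apply: finite_indexS fK => //.
by apply: sumset_subr; apply: subgroup0.
Qed.

Lemma compact_parafinite0 : compact_parafinite ([set 0] : set M).
Proof.
split; first exact: submodule_set0.
by split; [exact: compact_set1|move=> K [[K0 _] _] _ _ _ _ ->].
Qed.

(** Compact parafinite submodules are directed under sums, so the subgroup they generate is already
    their union. *)
Lemma WflatP x : Wflat M x <-> exists2 N : set M, compact_parafinite N & N x.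
Proof.
split; last by move=> [N pN Nx]; apply: sub_gen_subgroup; exists N.
pose L := [set x | exists2 N : set M, compact_parafinite N & N x].
move=> /(_ L); apply=> [|y [N pN Ny]]; last by exists N.
split; first by exists [set 0] => //; exact: compact_parafinite0.
move=> y z [N pN Ny] [N' pN' Nz]; exists (sumset N N').
  exact: compact_parafinite_sumset.
by apply: sumsetP => //; apply: subgroupN => //; case: pN' => -[].
Qed.

Lemma Wflat_submodule : submodule (Wflat M).
Proof.
split; first exact: gen_subgroupP.
move=> a x /WflatP[N pN Nx]; apply/WflatP; exists N => //.
by have [[_ aN] _] := pN; apply: aN.
Qed.

Lemma Omegasharp_submodule : submodule (Omegasharp M).
Proof.
split; first split.
- by move=> U [sU _] _ _; apply: subgroup0.
- move=> x y Ox Oy U mU oU qU; have [sU _] := mU.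
  by apply: subgroupB => //; [apply: Ox|apply: Oy].
- by move=> a x Ox U mU oU qU; have [_ aU] := mU; apply: aU; apply: Ox.
Qed.

(** The image of a compact submodule in the discrete module M/U is finite, hence zero when M/U is
    purely discrete. *)
Lemma Wflat_sub_Omegasharp : Wflat M `<=` Omegasharp M.
Proof.
move=> x /WflatP[N pN Nx] U mU oU qU.
have [[sN _] [cN _]] := pN; have [sU _] := mU.
apply: (quotient_purely_discrete_sub mU qU _ _ Nx); first by case: pN.
exact: compact_cosets.
Qed.

Lemma quotient_purely_discreteI U U' : submodule U -> submodule U' ->
  open U -> open U' -> quotient_purely_discrete U -> quotient_purely_discrete U' ->
  quotient_purely_discrete (U `&` U').
Proof.
move=> mU mU' oU oU' qU qU'; split.
  move=> x; apply: coset_open; last exact: openI.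
  by apply: subgroupI; [case: mU|case: mU'].
move=> V mV _ fV; rewrite subsetI; split; apply: quotient_purely_discrete_sub => //;
  by apply: finite_indexS fV => // x [].
Qed.

(** * The action of a compact generating set *)

Lemma generated_submodule (K : set A) S : gen_subgroup K = [set: A] ->
  is_subgroup S -> (forall a x, K a -> S x -> S (act M a x) /\ S (act M (- a) x)) ->
  submodule S.
Proof.
move=> gK sS KS; split=> // a x Sx.
(* Asking both [a] and [- a] to preserve [S] is what makes [H] closed under subtraction. *)
pose H := [set a | forall x, S x -> S (act M a x) /\ S (act M (- a) x)].
have : gen_subgroup K a by rewrite gK.
move=> /(_ H) Ha; suff /(_ x Sx)[] : H a by [].
apply: Ha => [|b Kb y]; last exact: KS.
split=> [y Sy|b c Hb Hc y Sy]; first by rewrite oppr0 act_zero.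
rewrite opprB [c - b]addrC !act_comp.
by split; [apply: (Hb _ (Hc _ Sy).2).1|apply: (Hb _ (Hc _ Sy).1).2].
Qed.

Lemma compactly_generated_symmetric : compactly_generated A ->
  exists K : set A,
    [/\ compact K, gen_subgroup K = [set: A] & forall a, K a -> K (- a)].
Proof.
move=> [K [cK gK]]; exists (K `|` -%R @` K); split.
- by apply: compactU => //; apply: compact_opp.
- apply/seteqP; split=> // a _ H sH KH.
  have : gen_subgroup K a by rewrite gK.
  by apply=> // b Kb; apply: KH; left.
- by move=> a [Ka|[b Kb <-]]; [right; exists a|left; rewrite opprK].
Qed.

(** A tube argument: every [a] in [K] sends 0 to 0, and joint continuity of the action is made
    uniform over [K]. *)
Lemma compact_stable_nbhs (K : set A) U : compact K -> nbhs 0 U ->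
  nbhs 0 [set x : M | forall a, K a -> U (act M a x)].
Proof.
move=> /compact_near_coveringP cK U0.
apply: (cK _ _ (fun x a => U (act M a x))) => a Ka.
by have := @act_continuous A M (a, 0) U; rewrite /= act0; apply.
Qed.

(** * Openness of the augmented codiscrete radical *)

Lemma Omegasharp_open : compactly_generated A -> open (Omegasharp M).
Proof.
move=> /compactly_generated_symmetric[K [cK gK Ksym]].
have [C [V [sC oC cV CV]]] := open_subgroup_compact_mod_core (@lc_locally_compact A M).
have sD := @open_core_subgroup M.
pose KC := [set act M a x | a in K & x in C].
have [s KCs] : finite_index KC C.
  have [s KVs] := compact_cosets (compact_act cK cV) sC oC.
  (* The [open_core] part of a point of [C] stays in [open_core], hence in [C], under the action. So
     the cosets covering the compact set of all [act M a v] also cover [KC]. *)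
  exists s => _ [a Ka [x /CV[v Vv [d Dd <-]] <-]]; rewrite act_add.
  have [|z zs Cz] := KVs (act M a v); first by exists a => //; exists v.
  exists z => //; rewrite /coset /= addrAC; apply: subgroupD => //.
  exact: act_open_core.
pose fam U := [/\ submodule U, open U & quotient_purely_discrete U].
have [|U0 [mU0 oU0 qU0] U0min] := @minimal_finite_trace _ _ fam s
    (fun U z => exists y, [/\ KC y, U y & C (y - z)]).
  exists setT; split; [by split|exact: openT|split=> // x].
  by apply: coset_open => //; exact: openT.
apply: nbhs_subgroup_open; first by case: Omegasharp_submodule.
have CU0 : nbhs 0 (C `&` U0).
  apply: open_nbhs_nbhs; split; first exact: openI.
  by split; apply: subgroup0 => //; case: mU0.
apply: filterS CU0 => x [Cx U0x] U mU oU qU.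
pose U2 := U0 `&` U; have [sU0 aU0] := mU0; have [sU aU] := mU.
have mU2 : submodule U2 by exact: submoduleI.
have oU2 : open U2 by exact: openI.
have qU2 : quotient_purely_discrete U2 by exact: quotient_purely_discreteI.
have sU2 : is_subgroup U2 by case: mU2.
(* By minimality the coset of [C] containing [y] also contains a point [z'] of [KC] in [U2]; then
   [y - z'] lies in both [C] and [U0]. *)
have KCU0 y : KC y -> U0 y -> sumset (C `&` U0) U2 y.
  move=> KCy U0y; have [z zs Cyz] := KCs _ KCy.
  have [j js [w [? [? ?] ?]]|| z' [KCz' U2z' Cz'z]] := U0min U2 (And3 mU2 oU2 qU2) _ z zs.
  - by exists w.
  - by exists y.
  rewrite -(subrK z' y); apply: sumsetP => //; split.
    exact: (subgroup_same_coset sC Cyz Cz'z).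
  by apply: subgroupB => //; case: U2z'.
have mCU : submodule (sumset (C `&` U0) U2).
  have sCU : is_subgroup (sumset (C `&` U0) U2).
    by apply: subgroup_sumset => //; apply: subgroupI.
  apply: (generated_submodule gK) => // a _ Ka [c [Cc U0c] [u U2u <-]].
  have aux b : K b -> sumset (C `&` U0) U2 (act M b (c + u)).
    move=> Kb; rewrite act_add; apply: (subgroupD sCU).
      by apply: KCU0; [exists b => //; exists c|apply: aU0].
    apply: sumset_subr; last by case: mU2 => _; apply.
    by split; apply: subgroup0.
  by split; apply: aux => //; apply: Ksym.
suff /(_ x) : sumset (C `&` U0) U2 `<=` U2.
  by case=> //; apply: sumset_subl => //; apply: subgroup0.
apply: quotient_purely_discrete_sub => //; apply: finite_index_sumset => //.
(* [C] lies in [V + open_core] and the open subgroup [U2] contains [open_core], so finitely many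
   cosets of [U2] covering [V] also cover [C]. *)
have [t Vt] := compact_cosets cV sU2 oU2.
exists t => y [/CV[v Vv [d Dd <-]] _]; have [z zt U2z] := Vt _ Vv.
exists z => //; rewrite /coset /= addrAC; apply: subgroupD => //.
exact: Dd.
Qed.

(** A submodule in which [Omegasharp M] has finite index is also finite modulo each larger [U] of
    the defining family, so it lies in every such [U]. *)
Lemma Omegasharp_quotient_purely_discrete :
  compactly_generated A -> quotient_purely_discrete (Omegasharp M).
Proof.
move=> /Omegasharp_open oO; have [sO _] := Omegasharp_submodule.
split=> [x|V mV _ fV x Vx U mU oU qU]; first exact: coset_open.
apply: (quotient_purely_discrete_sub mU qU mV _ Vx).
by apply: finite_indexS fV => // y; apply.
Qed.

(** * Compactness of the reduced polycompact radical *)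

Lemma Wflat_compact_parafinite : compactly_generated A ->
  compact_parafinite (Wflat M).
Proof.
move=> /compactly_generated_symmetric[K [cK gK Ksym]].
have hM := @lc_hausdorff A M.
have [C [U [sC cC CH U0 HU]]] :=
  compact_subgroup_open_in_compact_elements (@lc_locally_compact A M).
pose H : set M := closure compact_elements; rewrite -/H in CH HU.
have sH : is_subgroup H by apply: closure_subgroup; exact: compact_elements_subgroup.
(* [K] maps [C'] into [C], and [C'] is relatively open in [H], hence of finite index in the compact
   group [C]. *)
pose C' := [set x : M | C x /\ forall a, K a -> C (act M a x)].
have sC' : is_subgroup C'.
  split; first by split=> [|a _]; rewrite ?act0; apply: subgroup0.
  move=> x y [Cx aCx] [Cy aCy]; split; first exact: subgroupB.
  by move=> a Ka; rewrite actB; apply: subgroupB; [|apply: aCx|apply: aCy].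
pose U' := [set x : M | forall a, K a -> U (act M a x)] `&` U.
have U'0 : nbhs 0 U' by apply: filterI => //; exact: compact_stable_nbhs.
have HU' : H `&` U' `<=` C'.
  move=> x [Hx [Ux1 Ux2]]; split=> [|a Ka]; apply: HU; split=> //.
    by apply: act_closure Hx => y; apply: act_compact_elements.
  exact: Ux1.
have [s Cs] : finite_index C C'.
  by apply: (compact_finite_index cC sC U'0) => x [/CH Hx U'x]; apply: HU'.
(* The trace is negated: minimality of the set of missed centres makes [N0] maximal for the centres
   in [C' + N]. *)
have [|N0 pN0 N0max] := @minimal_finite_trace _ _ (@compact_parafinite A M) s
    (fun N z => ~ sumset C' N z); first by exists [set 0]; exact: compact_parafinite0.
have [mN0 [cN0 _]] := pN0; have [sN0 aN0] := mN0.
have bound N : compact_parafinite N -> N `<=` sumset C N0.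
  move=> pN; pose N1 := sumset N N0.
  have pN1 : compact_parafinite N1 by exact: compact_parafinite_sumset.
  have [mN1 [cN1 _]] := pN1; have [sN1 aN1] := mN1.
  have [mN [cN _]] := pN; have [sN aN] := mN.
  have NN1 : N `<=` N1 by apply: sumset_subl; apply: subgroup0.
  have N01 : N0 `<=` N1 by apply: sumset_subr; apply: subgroup0.
  have N1H : N1 `<=` H by move=> x N1x; apply: subset_closure; exists N1.
  have N1C z : z \in s -> sumset C' N1 z -> sumset C' N0 z.
    move=> zs N1z; apply: contrapT => nN0z; apply: (N0max N1 pN1) nN0z N1z => //.
    move=> j js nN1 [c Cc [n Nn cn]]; apply: nN1; exists c => //; exists n => //.
    exact: N01.
  pose P := N1 `&` sumset C N0.
  have sCN0 : is_subgroup (sumset C N0) by exact: subgroup_sumset.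
  have sCN0' : is_subgroup (sumset C' N0) by exact: subgroup_sumset.
  (* Write [x = c + n] with [c] in the coset of [C'] centred at [z]. As [N0] lies in [N1], so does
     [c]; hence [z] is in [C' + N1], and by maximality in [C' + N0]. *)
  have PC' x : P x -> sumset C' N0 x.
    move=> [N1x [c Cc [n Nn cn]]]; have [z zs C'cz] := Cs _ Cc.
    have N1c : N1 c by rewrite -(addrK n c) cn; apply: (subgroupB sN1) => //; apply: N01.
    have N1z : sumset C' N1 z.
      by rewrite -(subKr c z) addrC; apply: sumsetP => //; apply: subgroupN.
    rewrite -cn -(subrK z c) -addrA; apply: (subgroupD sCN0').
      by apply: sumset_subl => //; apply: subgroup0.
    apply: (subgroupD sCN0'); first exact: N1C.
    by apply: sumset_subr => //; apply: subgroup0.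
  (* [K] maps [C' + N0] into [C + N0], so the inclusion just proved makes [P] stable under [K]. *)
  have mP : submodule P.
    apply: (generated_submodule gK); first exact: subgroupI.
    move=> a x Ka Px; have aux b : K b -> P (act M b x).
      move=> Kb; have [c [_ aCc] [n Nn cn]] := PC' _ Px.
      split; first by case: Px => N1x _; apply: aN1.
      by rewrite -cn act_add; apply: sumsetP; [apply: aCc|apply: aN0].
    by split; apply: aux => //; apply: Ksym.
  have cP : closed P.
    apply: closedI; first exact: compact_closed.
    by apply: compact_closed => //; apply: compact_sumset.
  (* The compact subgroup [N1] lies in [H], so its points in [U] belong to [C], and [P] is
     relatively open in [N1]. *)
  have fP : finite_index N1 P.
    apply: (compact_finite_index cN1 sN1 U0) => x [N1x Ux]; split=> //.
    apply: sumset_subl; first exact: subgroup0.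
    by apply: HU; split=> //; apply: N1H.
  by move=> x /NN1 /(compact_parafinite_sub pN1 mP cP fP)[].
have mW := Wflat_submodule.
have cW : compact (closure (Wflat M)).
  have cCN0 : compact (sumset C N0) by apply: compact_sumset.
  apply: (subclosed_compact _ cCN0); first exact: closed_closure.
  have /closure_id -> : closed (sumset C N0) by apply: compact_closed.
  by apply: closureS => x /WflatP[N /bound]; apply.
have pW : compact_parafinite (closure (Wflat M)).
  split; first exact: submodule_closure.
  split=> // L mL cL _ fL; rewrite ((closure_id L).1 cL); apply: closureS.
  move=> x /WflatP[N pN Nx].
  apply: (compact_parafinite_sub pN mL cL _ Nx); apply: finite_indexS fL => //.
  by move=> y Ny; apply: subset_closure; apply/WflatP; exists N.
(* The closure is itself one of the submodules whose union is [Wflat M], so [Wflat M] is already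
   closed. *)
suff -> : Wflat M = closure (Wflat M) by [].
apply/seteqP; split; first exact: subset_closure.
by move=> x Wx; apply/WflatP; exists (closure (Wflat M)).
Qed.

End Modules.

(** * Transfer of submodules, finite index and compactness along a subquotient map *)

Section Subquotients.
Context (A : topologicalZmodType) (M Q : lcmod A) (H L : set M) (pi : M -> Q).
Hypothesis mH : submodule H.
Hypothesis oH : open H.
Hypothesis pi_sq : is_subquotient H L pi.

Let sH : is_subgroup H. Proof. by case: mH. Qed.
Let aH a x : H x -> H (act M a x). Proof. by case: mH => _; apply. Qed.

Lemma subquotientD x y : H x -> H y -> pi (x + y) = pi x + pi y.
Proof. by case: pi_sq => + _; apply. Qed.

Lemma subquotient_act a x : H x -> pi (act M a x) = act Q a (pi x).
Proof. by case: pi_sq => _ [+ _]; apply. Qed.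

Lemma subquotient_surj q : exists2 x, H x & pi x = q.
Proof. by case: pi_sq => _ [_ [/seteqP[_ /(_ q I)[x Hx xq]] _]]; exists x. Qed.

Lemma subquotient_ker x : H x -> (pi x = 0 <-> L x).
Proof. by case: pi_sq => _ [_ [_ [+ _]]]; apply. Qed.

Lemma subquotient_cts x : H x -> {for x, continuous pi}.
Proof.
move=> Hx; case: pi_sq => _ [_ [_ [_ [+ _]]]].
by rewrite continuous_open_subspace//; apply; rewrite inE.
Qed.

Lemma subquotient_open (O : set M) : open O -> open (pi @` (H `&` O)).
Proof. by case: pi_sq => _ [_ [_ [_ [_ +]]]]; apply. Qed.

Lemma subquotient0 : pi 0 = 0.
Proof.
have := subquotientD (subgroup0 sH) (subgroup0 sH); rewrite addr0.
by move=> /esym/(canRL (addrK _)); rewrite subrr.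
Qed.

Lemma subquotientB x y : H x -> H y -> pi (x - y) = pi x - pi y.
Proof.
move=> Hx Hy; apply: (addIr (pi y)); rewrite subrK -subquotientD ?subrK//.
exact: subgroupB.
Qed.

Lemma subquotient_eq x y : H x -> H y -> pi x = pi y -> L (x - y).
Proof.
move=> Hx Hy xy; apply/subquotient_ker; first exact: subgroupB.
by rewrite subquotientB// xy subrr.
Qed.

Lemma subquotient_preimage_submodule (S : set Q) :
  submodule S -> submodule (H `&` pi @^-1` S).
Proof.
move=> [sS aS]; split; first split.
- by split; [exact: (subgroup0 sH)|rewrite /= subquotient0; exact: (subgroup0 sS)].
- move=> x y [Hx Sx] [Hy Sy]; split; first exact: (subgroupB sH).
  by rewrite /= subquotientB//; exact: (subgroupB sS).
- move=> a x [Hx Sx]; split; first exact: aH.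
  by rewrite /= subquotient_act//; exact: aS.
Qed.

Lemma subquotient_image_submodule (S : set M) :
  submodule S -> S `<=` H -> submodule (pi @` S).
Proof.
move=> [sS aS] SH; split; first split.
- by exists 0; [exact: subgroup0|exact: subquotient0].
- move=> _ _ [x Sx <-] [y Sy <-]; exists (x - y); first exact: subgroupB.
  by apply: subquotientB; apply: SH.
- move=> a _ [x Sx <-]; exists (act M a x); first exact: aS.
  by rewrite subquotient_act//; exact: SH.
Qed.

(** [pi] is additive only on [H], so the coset centres are first moved into [S]. *)
Lemma subquotient_image_finite_index (S T : set M) : is_subgroup S -> is_subgroup T ->
  S `<=` H -> T `<=` H -> finite_index S T -> finite_index (pi @` S) (pi @` T).
Proof.
move=> sS sT SH TH fST; have [s Ss] := finite_index_setI sS sT fST.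
exists [seq pi x | x <- s] => _ [x Sx <-]; have [y ys [Sxy Txy]] := Ss _ Sx.
exists (pi y); first exact: map_f.
exists (x - y) => //; apply: subquotientB; first exact: SH.
by rewrite -(subKr x y); apply: (subgroupB sH); apply: SH.
Qed.

(** Openness of [pi] lets finitely many images of translates of a compact neighbourhood [V] cover
    [N]. The preimage is closed and lies in the compact sum of the translation points, [V] and
    [L]. *)
Lemma subquotient_preimage_compact (N : set Q) : compact L -> compact N ->
  compact (H `&` pi @^-1` N).
Proof.
move=> cL cN.
have cH : closed H by exact: open_subgroup_closed.
have cP : closed (H `&` pi @^-1` N).
  move=> x cx; have Hx : H x by apply: cH; apply: closureS cx => y [].
  split=> //; apply: (compact_closed (@lc_hausdorff A Q) cN) => B.
  by move=> /(subquotient_cts Hx) /cx[y [[_ Ny] By]]; exists (pi y).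
have [V [V0 cV _]] := symmetric_compact_nbhs0 (@lc_locally_compact A M).
have /choice[r rP] q : exists x, H x /\ pi x = q.
  by have [x Hx xq] := subquotient_surj q; exists x.
pose f q := pi @` (H `&` [set y | V° (y - r q)]).
have fN q : N q -> nbhs q (f q).
  move=> _; have [Hr rq] := rP q; apply: open_nbhs_nbhs; split.
    apply: subquotient_open; apply: (@open_comp M M (fun y => y - r q)).
      by move=> y _; exact: subl_continuous.
    exact: open_interior.
  by exists (r q) => //; split=> //=; rewrite subrr; exact: V0.
have [s _ Ns] := compact_finite_cover cN fN.
pose X := sumset [set` [seq r q | q <- s]] (sumset V L).
apply: (@subclosed_compact _ _ X) => //.
  apply: compact_sumset; last exact: compact_sumset.
  by apply: finite_compact; exact: finite_seq.
move=> x [Hx Nx]; have [q qs [y [Hy Vy] yx]] := Ns _ Nx.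
have Lxy := subquotient_eq Hx Hy (esym yx).
(* The decomposition is [x = r q + ((y - r q) + (x - y))], with terms in the finite set, [V] and
   [L]. *)
rewrite -(subrK y x) addrC -{1}(subrK (r q) y) -addrA [_ + (r q + _)]addrCA.
apply: sumsetP; first exact: map_f.
by apply: sumsetP => //; exact: interior_subset.
Qed.

End Subquotients.

(** * Sheerness of the subquotient *)

Section Sheer.
Context (A : topologicalZmodType) (M Q : lcmod A) (pi : M -> Q).
Hypothesis cgA : compactly_generated A.
Hypothesis pi_sq : is_subquotient (Omegasharp M) (Wflat M) pi.

Let mO := @Omegasharp_submodule A M.
Let oO := @Omegasharp_open A M cgA.
Let pW := @Wflat_compact_parafinite A M cgA.

(** Compact parafinite modules are stable under extension. The preimage [P] of a compact parafinite
    [N] is thus compact parafinite, so it lies in [Wflat M], which [pi] kills. *)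
Lemma subquotient_Wflat0 : Wflat Q = [set 0].
Proof.
apply/seteqP; split; last first.
  by move=> _ ->; apply/WflatP; exists [set 0] => //; exact: compact_parafinite0.
move=> q /WflatP[N pN Nq]; have [mN [cN _]] := pN; have [mW [cW _]] := pW.
have [sO _] := mO.
pose P := Omegasharp M `&` pi @^-1` N.
have mP : submodule P by exact: (subquotient_preimage_submodule mO pi_sq).
have cP : compact P by exact: (subquotient_preimage_compact mO oO pi_sq).
have WP : Wflat M `<=` P.
  move=> x Wx; have Ox := Wflat_sub_Omegasharp Wx; split=> //=.
  have [_ ->] := subquotient_ker pi_sq Ox; last by [].
  by apply: subgroup0; case: mN.
have pP : compact_parafinite P.
  split=> //; split=> // K mK clK KP fK; have [sK _] := mK; have [sP _] := mP.
  have WK : Wflat M `<=` K.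
    by apply: compact_parafinite_sub => //; apply: finite_indexS fK.
  have KO : K `<=` Omegasharp M by move=> x /KP[].
  have PO : P `<=` Omegasharp M by move=> x [].
  have cK : compact K by exact: subclosed_compact KP.
  have NK : N `<=` pi @` K.
    apply: compact_parafinite_sub => //.
    - exact: (subquotient_image_submodule mO pi_sq).
    - apply: compact_closed; first exact: lc_hausdorff.
      apply: continuous_compact => //; apply: continuous_subspaceW KO _.
      by case: pi_sq => _ [_ [_ [_ []]]].
    - have := subquotient_image_finite_index mO pi_sq sP sK PO KO fK.
      apply: finite_indexS => // n Nn; have [x Ox xn] := subquotient_surj pi_sq n.
      by exists x => //; split=> //=; rewrite xn.
  (* [K] contains [Wflat M], the kernel of [pi], and its image contains [N]; so it contains all of
     [P]. *)
  move=> x [Ox /NK[y Ky yx]]; rewrite -(subrK y x).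
  apply: subgroupD => //; apply: WK.
  by apply: (subquotient_eq mO pi_sq) => //; apply: KO.
have [x Ox xq] := subquotient_surj pi_sq q.
rewrite /= -xq; apply/(subquotient_ker pi_sq Ox)/WflatP; exists P => //.
by split=> //=; rewrite xq.
Qed.

(** Dually, the preimage [P] of [U] has a purely discrete quotient: a submodule [V] finite over [P]
    first falls into [Omegasharp M], and its image then falls into [U]. Hence [P] contains
    [Omegasharp M]. *)
Lemma subquotient_OmegasharpT : Omegasharp Q = [set: Q].
Proof.
have [sO _] := mO.
apply/seteqP; split=> // q _ U mU oU [_ qU]; have [sU _] := mU.
pose P := Omegasharp M `&` pi @^-1` U.
have mP : submodule P by exact: (subquotient_preimage_submodule mO pi_sq).
have [sP _] := mP.
have PO : P `<=` Omegasharp M by move=> x [].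
have oP : open P.
  rewrite openE => x [Ox Ux]; apply: filterI; first by apply: open_nbhs_nbhs.
  by apply: (subquotient_cts oO pi_sq Ox); apply: open_nbhs_nbhs.
have UP : U `<=` pi @` P.
  move=> u Uu; have [x Ox xu] := subquotient_surj pi_sq u.
  by exists x => //; split=> //=; rewrite xu.
have qP : quotient_purely_discrete P.
  split=> [x|V mV PV fV]; first exact: coset_open.
  have [sV _] := mV.
  have VO : V `<=` Omegasharp M.
    apply: quotient_purely_discrete_sub => //.
      exact: Omegasharp_quotient_purely_discrete.
    exact: finite_indexS fV.
  have VU : pi @` V `<=` U.
    apply: qU; first exact: (subquotient_image_submodule mO pi_sq).
      by move=> u /UP[x /PV Vx xu]; exists x.
    have := subquotient_image_finite_index mO pi_sq sV sP VO PO fV.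
    by apply: finite_indexS => // _ [x [_ Ux] <-].
  by move=> x Vx; split; [exact: VO|apply: VU; exists x].
have [x Ox <-] := subquotient_surj pi_sq q.
by have [] := Ox _ mP oP qP.
Qed.

End Sheer.

(** * Construction of the subquotient as an LC module *)

Section SubquotientModule.
Context (A : topologicalZmodType) (M : lcmod A) (H L : set M).
Hypothesis mH : submodule H.
Hypothesis oH : open H.
Hypothesis mL : submodule L.
Hypothesis clL : closed L.
Hypothesis LH : L `<=` H.

Let sH : is_subgroup H. Proof. by case: mH. Qed.
Let sL : is_subgroup L. Proof. by case: mL. Qed.
Let aH a x : H x -> H (act M a x). Proof. by case: mH => _; apply. Qed.
Let aL a x : L x -> L (act M a x). Proof. by case: mL => _; apply. Qed.

(** The choice depends only on the coset as a set, so congruent elements share a representative. The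
    default 0 never arises, as [x] lies in its own coset. *)
Definition coset_repr (x : M) : M := xget 0 (coset L x).

Lemma coset_reprP x : L (coset_repr x - x).
Proof.
apply: (@xgetPex _ 0 (coset L x)); exists x.
by rewrite /coset /= subrr; apply: subgroup0.
Qed.

Lemma eq_coset_repr x y : L (x - y) -> coset_repr x = coset_repr y.
Proof.
move=> Lxy; rewrite /coset_repr; congr (xget 0); apply/seteqP; split=> z Lz.
  by rewrite /coset /= -(subrKA x); apply: (subgroupD sL).
rewrite /coset /= -(subrKA y); apply: (subgroupD sL) => //.
by rewrite -opprB; apply: subgroupN.
Qed.

(** A coset is encoded by its chosen representative. The dummy [let] makes the type depend on all
    the hypotheses, so that its algebraic and topological instances can refer to them. *)
Definition subquotient_type : Type :=
  let _ := (mH, oH, mL, clL, LH) in {x : M | `[< H x /\ coset_repr x = x >]}.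
Local Notation T := subquotient_type.

HB.instance Definition _ := Choice.on T.

Definition subquotient_val (u : T) : M := sval u.
Local Notation val := subquotient_val.

Lemma subquotient_valP u : H (val u).
Proof. by case: u => x /= /asboolP[]. Qed.

Lemma coset_repr_class x : H x ->
  `[< H (coset_repr x) /\ coset_repr (coset_repr x) = coset_repr x >].
Proof.
move=> Hx; apply/asboolP; split; last exact/eq_coset_repr/coset_reprP.
rewrite -(subrK x (coset_repr x)); apply: subgroupD => //.
by apply: LH; apply: coset_reprP.
Qed.

(* Off [H] the value is the junk [0]. *)
Definition subquotient_pi (x : M) : T :=
  if pselect (H x) is left Hx then exist _ (coset_repr x) (coset_repr_class Hx)
  else exist _ (coset_repr 0) (coset_repr_class (subgroup0 sH)).
Local Notation pi := subquotient_pi.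

Lemma val_subquotient_pi x : H x -> L (val (pi x) - x).
Proof. by rewrite /pi; case: pselect => // Hx _; exact: coset_reprP. Qed.

Lemma subquotient_val_inj : injective val.
Proof. by move=> u v; exact: val_inj. Qed.

Lemma eq_subquotient_pi x y : H x -> H y -> (pi x = pi y) <-> L (x - y).
Proof.
move=> Hx Hy; split=> [xy|Lxy].
  have Lx := val_subquotient_pi Hx; have Ly := val_subquotient_pi Hy.
  rewrite -(subrKA (val (pi x))) -opprB; apply: (subgroupD sL).
    exact: subgroupN.
  by rewrite xy.
apply: subquotient_val_inj; rewrite /pi.
by case: pselect => // ?; case: pselect => // ? /=; exact: eq_coset_repr.
Qed.

Lemma subquotient_valK : cancel val pi.
Proof.
move=> u; apply: subquotient_val_inj; have Hu := subquotient_valP u.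
by rewrite /pi; case: pselect => // ? /=; case: (u) => x /= /asboolP[].
Qed.

Definition subquotient_add (u v : T) : T := pi (val u + val v).
Definition subquotient_opp (u : T) : T := pi (- val u).
Definition subquotient_action (a : A) (u : T) : T := pi (act M a (val u)).

Lemma subquotient_piD x y : H x -> H y -> subquotient_add (pi x) (pi y) = pi (x + y).
Proof.
move=> Hx Hy; apply/eq_subquotient_pi.
- by apply: subgroupD => //; exact: subquotient_valP.
- exact: subgroupD.
- by rewrite opprD addrACA; apply: (subgroupD sL); exact: val_subquotient_pi.
Qed.

Lemma subquotient_piN x : H x -> subquotient_opp (pi x) = pi (- x).
Proof.
move=> Hx; apply/eq_subquotient_pi.
- by apply: subgroupN => //; exact: subquotient_valP.
- exact: subgroupN.
- by rewrite -opprD; apply: (subgroupN sL); exact: val_subquotient_pi.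
Qed.

Lemma subquotient_pi_act a x : H x -> subquotient_action a (pi x) = pi (act M a x).
Proof.
move=> Hx; apply/eq_subquotient_pi.
- by apply: aH; exact: subquotient_valP.
- exact: aH.
- by rewrite -actB; apply: aL; exact: val_subquotient_pi.
Qed.

Lemma subquotient_piP u : exists2 x, H x & u = pi x.
Proof. by exists (val u); [exact: subquotient_valP|rewrite subquotient_valK]. Qed.

Fact subquotient_addA : associative subquotient_add.
Proof.
move=> u v w; have [x Hx ->] := subquotient_piP u.
have [y Hy ->] := subquotient_piP v; have [z Hz ->] := subquotient_piP w.
by rewrite !subquotient_piD ?addrA//; exact: (subgroupD sH).
Qed.

Fact subquotient_addC : commutative subquotient_add.
Proof. by move=> u v; rewrite /subquotient_add addrC. Qed.

Fact subquotient_add0 : left_id (pi 0) subquotient_add.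
Proof.
move=> u; have [x Hx ->] := subquotient_piP u.
by rewrite subquotient_piD ?add0r//; exact: (subgroup0 sH).
Qed.

Fact subquotient_addN : left_inverse (pi 0) subquotient_opp subquotient_add.
Proof.
move=> u; have [x Hx ->] := subquotient_piP u.
by rewrite subquotient_piN// subquotient_piD ?addNr//; exact: (subgroupN sH).
Qed.

HB.instance Definition _ := GRing.isZmodule.Build T
  subquotient_addA subquotient_addC subquotient_add0 subquotient_addN.

(** The quotient topology of H/L. Intersecting with [H] discards the junk values of [pi], and since
    [H] is open, open in [H] and open in [M] agree. *)
Definition subquotient_is_open (O : set T) : Prop := open (H `&` pi @^-1` O).

Fact subquotient_is_openT : subquotient_is_open setT.
Proof. by rewrite /subquotient_is_open preimage_setT setIT. Qed.

Fact subquotient_is_openI : setI_closed subquotient_is_open.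
Proof.
by move=> O O' oO oO'; rewrite /subquotient_is_open preimage_setI setIIr; exact: openI.
Qed.

Fact subquotient_is_open_bigcup (I : Type) (f : I -> set T) :
  (forall i, subquotient_is_open (f i)) -> subquotient_is_open (\bigcup_i f i).
Proof.
move=> of_; rewrite /subquotient_is_open preimage_bigcup setI_bigcupr.
by apply: bigcup_open => i _; exact: of_.
Qed.

HB.instance Definition _ := isOpenTopological.Build T
  subquotient_is_openT subquotient_is_openI subquotient_is_open_bigcup.

Lemma subquotient_pi_cts x O : H x -> nbhs (pi x) O -> nbhs x (H `&` pi @^-1` O).
Proof.
move=> Hx; rewrite nbhsE => -[B [oB Bx] BO].
have : nbhs x (H `&` pi @^-1` B) by apply: open_nbhs_nbhs.
by apply: filterS => y [Hy /BO].
Qed.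

(** If [pi x = pi y] with [y] in [O], translation by [y - x], an element of [L], carries a
    neighbourhood of [x] into [O] without changing [pi]. *)
Lemma subquotient_pi_open (O : set M) : open O -> open (pi @` (H `&` O)).
Proof.
move=> oO; rewrite /open /= /subquotient_is_open openE => x [Hx [y [Hy Oy] yx]].
have : nbhs (y - x + x) (H `&` O).
  by rewrite subrK; apply: open_nbhs_nbhs; split=> //; exact: openI.
move=> /nbhs_translate; apply: filterS => z /= [Hz Oz].
have Hz' : H z.
  rewrite -(addKr (y - x) z); apply: subgroupD => //.
  by apply: subgroupN => //; apply: subgroupB.
split=> //; exists (y - x + z) => //.
by apply/eq_subquotient_pi => //; rewrite addrK; apply/eq_subquotient_pi.
Qed.

Lemma subquotient_pi_nbhs x V : H x -> nbhs x V -> nbhs (pi x) (pi @` (H `&` V)).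
Proof.
move=> Hx; rewrite nbhsE => -[B [oB Bx] BV].
have : nbhs (pi x) (pi @` (H `&` B)).
  by apply: open_nbhs_nbhs; split; [exact: subquotient_pi_open|exists x].
by apply: filterS => _ [y [Hy /BV Vy] <-]; exists y.
Qed.

Lemma subquotient_piB x y : H x -> H y -> pi x - pi y = pi (x - y).
Proof.
move=> Hx Hy; rewrite -subquotient_piD//; last exact: subgroupN.
by rewrite -subquotient_piN.
Qed.

Fact subquotient_sub_continuous : continuous (fun u : T * T => u.1 - u.2).
Proof.
move=> [u v] O /=; have [x Hx ->] := subquotient_piP u.
have [y Hy ->] := subquotient_piP v.
rewrite subquotient_piB// => /(subquotient_pi_cts (subgroupB sH Hx Hy)).
move=> /(@sub_continuous M (x, y)) [[V W] [/= Vx Wy] VW].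
exists (pi @` (H `&` V), pi @` (H `&` W)).
  by split; exact: subquotient_pi_nbhs.
move=> [_ _] [/= [x' [Hx' Vx'] <-] [y' [Hy' Wy'] <-]].
by have [_] := VW (x', y') (conj Vx' Wy'); rewrite /= subquotient_piB.
Qed.

HB.instance Definition _ :=
  PreTopologicalNmodule_isTopologicalZmodule.Build T subquotient_sub_continuous.

(** If [x - y] is outside the closed set [L], then so are all differences of points near [x] and
    near [y]; the images of these neighbourhoods are disjoint. *)
Fact subquotient_hausdorff : hausdorff_space T.
Proof.
move=> u v; have [x Hx ->] := subquotient_piP u.
have [y Hy ->] := subquotient_piP v => cxy.
apply/eq_subquotient_pi => //; apply: contrapT => nL.
have : nbhs (x - y) (~` L).
  by apply: open_nbhs_nbhs; split=> //; exact: closed_openC.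
move=> /(@sub_continuous M (x, y)) [[V W] [/= Vx Wy] VW].
have [_ [[x' [Hx' Vx'] <-] [y' [Hy' Wy']]]] :=
  cxy _ _ (subquotient_pi_nbhs Hx Vx) (subquotient_pi_nbhs Hy Wy).
move=> yx; apply: (VW (x', y')) => //=.
exact/eq_subquotient_pi.
Qed.

Lemma subquotient_pi_continuous : {within H, continuous pi}.
Proof.
rewrite continuous_open_subspace// => x; rewrite inE => Hx O.
by move=> /(subquotient_pi_cts Hx); apply: filterS => y [].
Qed.

Fact subquotient_locally_compact : locally_compact [set: T].
Proof.
move=> u _; have [x Hx ->] := subquotient_piP u.
have [V [V0 cV _]] := symmetric_compact_nbhs0 (@lc_locally_compact A M).
pose W := H `&` sumset [set x] V.
have cW : compact W.
  rewrite /W setIC; apply: compact_closedI; last exact: open_subgroup_closed.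
  by apply: compact_sumset => //; exact: compact_set1.
have cpW : compact (pi @` W).
  apply: continuous_compact cW; apply: continuous_subspaceW subquotient_pi_continuous.
  by move=> ? [].
exists (pi @` W); last first.
  by split=> //; apply: compact_closed => //; exact: subquotient_hausdorff.
rewrite withinET; apply: subquotient_pi_nbhs => //.
apply: filterS (nbhs_translate0 x V0) => y /= Vyx.
by rewrite -(addrNK x y) addrC; apply: sumsetP.
Qed.

Fact subquotient_action_add a (u v : T) :
  subquotient_action a (u + v) = subquotient_action a u + subquotient_action a v.
Proof.
have [x Hx ->] := subquotient_piP u; have [y Hy ->] := subquotient_piP v.
rewrite [pi x + pi y]subquotient_piD// !subquotient_pi_act//; last exact: subgroupD.
by rewrite act_add [RHS]subquotient_piD//; exact: aH.
Qed.

Fact subquotient_action_zero (u : T) : subquotient_action 0 u = u.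
Proof.
have [x Hx ->] := subquotient_piP u.
by rewrite subquotient_pi_act// act_zero.
Qed.

Fact subquotient_action_comp a b (u : T) :
  subquotient_action (a + b) u = subquotient_action a (subquotient_action b u).
Proof.
have [x Hx ->] := subquotient_piP u.
by rewrite !subquotient_pi_act// ?act_comp//; exact: aH.
Qed.

Fact subquotient_action_continuous :
  continuous (fun p : A * T => subquotient_action p.1 p.2).
Proof.
move=> [a u] O /=; have [x Hx ->] := subquotient_piP u.
rewrite subquotient_pi_act// => /(subquotient_pi_cts (aH a Hx)).
move=> /(@act_continuous A M (a, x)) [[V W] [/= Va Wx] VW].
exists (V, pi @` (H `&` W)); first by split=> //; exact: subquotient_pi_nbhs.
move=> [b _] [/= Vb [y [Hy Wy] <-]].
by have [_] := VW (b, y) (conj Vb Wy); rewrite /= subquotient_pi_act.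
Qed.

Definition subquotient_lcmod : lcmod A :=
  @LCMod A T subquotient_action subquotient_hausdorff subquotient_locally_compact
    subquotient_action_add subquotient_action_zero subquotient_action_comp
    subquotient_action_continuous.

Lemma subquotient_lcmodP : @is_subquotient A M H L subquotient_lcmod pi.
Proof.
split; first by move=> x y Hx Hy; rewrite [RHS]subquotient_piD.
split; first by move=> a x Hx; rewrite [RHS]subquotient_pi_act.
split.
  by apply/seteqP; split=> // u _; have [x Hx ->] := subquotient_piP u; exists x.
split; last by split; [exact: subquotient_pi_continuous|exact: subquotient_pi_open].
move=> x Hx; rewrite -[in X in _ <-> X](subr0 x).
by apply: eq_subquotient_pi => //; exact: subgroup0.
Qed.

End SubquotientModule.

Theorem mainTheorem2 (A : topologicalZmodType) (M : lcmod A) :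
  LCA A ->
  [/\ submodule (Wflat M), submodule (Omegasharp M),
      [set 0] `<=` Wflat M, Wflat M `<=` Omegasharp M &
      Omegasharp M `<=` [set: lc_car M]] /\
  (compactly_generated A ->
   [/\ compact_parafinite (Wflat M),
       open (Omegasharp M),
       quotient_purely_discrete (Omegasharp M),
       (exists (Q : lcmod A) (pi : M -> Q),
           is_subquotient (Omegasharp M) (Wflat M) pi) &
       (forall (Q : lcmod A) (pi : M -> Q),
           is_subquotient (Omegasharp M) (Wflat M) pi -> sheer Q)]).
Proof.
move=> _; have mW := Wflat_submodule M; have mO := Omegasharp_submodule M.
have WO := @Wflat_sub_Omegasharp A M.
split; first by split=> // _ ->; apply: subgroup0; case: mW.
move=> cgA; have pW := Wflat_compact_parafinite M cgA.
have oO := Omegasharp_open M cgA.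
split=> //; first exact: Omegasharp_quotient_purely_discrete.
  have clW : closed (Wflat M).
    by case: pW => _ [cW _]; apply: compact_closed => //; exact: lc_hausdorff.
  exists (subquotient_lcmod mO oO mW clW WO), (subquotient_pi mO oO mW clW WO).
  exact: subquotient_lcmodP.
move=> Q pi pi_sq; split; first exact: (subquotient_Wflat0 cgA pi_sq).
exact: (subquotient_OmegasharpT cgA pi_sq).
Qed.
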